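(* The interface upstream mobility flux $\overline F:[0,1]\times[0,1]\to\mathbb{R}$ is Lipschitz in both its arguments, nondecreasing in the first argument and nonincreasing in the second argument. Furthermore, $$\overline F(0,0)=f^-(0)=f^+(0)=0,\qquad \overline F(1,1)=f^-(1)=f^+(1)=q.$$
   Context: Fix real constants $q,g_1,g_2$. For each sign $\pm$ let $\lambda_1^\pm,\lambda_2^\pm:[0,1]\to[0,\infty)$ be smooth, with $\lambda_1^\pm$ strictly increasing, $\lambda_1^\pm(0)=0$, and $\lambda_2^\pm$ strictly decreasing, $\lambda_2^\pm(1)=0$. Set $$f^\pm=\frac{\lambda_1^\pm}{\lambda_1^\pm+\lambda_2^\pm}\,[\,q+(g_1-g_2)\lambda_2^\pm\,]\quad\text{on }[0,1].$$ The interface upstream mobility flux is, for $a,b\in[0,1]$, $$\overline F(a,b)=\frac{\lambda_1^*}{\lambda_1^*+\lambda_2^*}\,[\,q+(g_1-g_2)\lambda_2^*\,],$$ where $(\lambda_1^*,\lambda_2^* )$ is the pair determined by the implicit rule: for $\{\ell,i\}=\{1,2\}$, $$\lambda_\ell^*=\begin{cases}\lambda_\ell^-(a)&\text{if } q+(g_\ell-g_i)\lambda_i^*>0,\\ \lambda_\ell^+(b)&\text{if } q+(g_\ell-g_i)\lambda_i^*\le0\end{cases}$$ (this determines the pair uniquely). *)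

(* Defs.v *)
From mathcomp Require Import all_boot all_order all_algebra.
From mathcomp Require Import mathcomp_extra boolp classical_sets set_interval reals.
From mathcomp Require Import topology normedtype.
From mathcomp Require Import ring.

Set Implicit Arguments.
Unset Strict Implicit.
Unset Printing Implicit Defensive.

Import Order.TTheory GRing.Theory Num.Theory.
Import numFieldTopology.Exports numFieldNormedType.Exports.

Local Open Scope classical_set_scope.
Local Open Scope ring_scope.

(* At an end point of an interval [A] this is the one-sided derivative. *)
Definition is_derive_in (R : realType) (A : set R) (f : R -> R) (x l : R) :=
  (f y - f x) / (y - x) @[y --> within A x^'] --> l.

(* [D n] is the [n]-th derivative of [f] relative to [A]; the values of [f]
   outside [A] are irrelevant. *)
Definition smooth_in (R : realType) (A : set R) (f : R -> R) :=
  exists D : nat -> R -> R,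
    {in A, D 0%N =1 f} /\
    forall n x, A x -> is_derive_in A (D n) x (D n.+1 x).

Record mobilities (R : realType) (l1 l2 : R -> R) : Prop := Mobilities {
  mob1_smooth : smooth_in `[0, 1] l1;
  mob2_smooth : smooth_in `[0, 1] l2;
  mob1_ge0 : {in `[0, 1], forall s, 0 <= l1 s};
  mob2_ge0 : {in `[0, 1], forall s, 0 <= l2 s};
  mob1_incr : {in `[0, 1] &, {homo l1 : s t / s < t}};
  mob2_decr : {in `[0, 1] &, {homo l2 : s t /~ s < t}};
  mob1_at0 : l1 0 = 0;
  mob2_at1 : l2 1 = 0
}.

Definition mobility_flux (R : realType) (q g1 g2 m1 m2 : R) : R :=
  m1 / (m1 + m2) * (q + (g1 - g2) * m2).

Definition phase_flux (R : realType) (q g1 g2 : R) (l1 l2 : R -> R) (s : R) :=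
  mobility_flux q g1 g2 (l1 s) (l2 s).

(* The implicit upwind rule for the pair [p] of interface mobilities, where
   [m1, m2] are the mobilities on the minus side and [p1, p2] those on the plus
   side. *)
Definition upstream_pair (R : realType) (q g1 g2 m1 m2 p1 p2 : R)
    (p : R * R) : Prop :=
  p.1 = (if 0 < q + (g1 - g2) * p.2 then m1 else p1) /\
  p.2 = (if 0 < q + (g2 - g1) * p.1 then m2 else p2).

Lemma upstream_pair_exists_unique (R : realType) (q g1 g2 m1 m2 p1 p2 : R) :
  0 <= m1 -> 0 <= m2 -> 0 <= p1 -> 0 <= p2 ->
  exists! p, upstream_pair q g1 g2 m1 m2 p1 p2 p.
Proof.
move=> hm1 hm2 hp1 hp2; rewrite /upstream_pair.
have E x : q + (g2 - g1) * x = q - (g1 - g2) * x by ring.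
set d := g1 - g2 in E *.
have [d0|d0] := leP 0 d; have [q0|q0] := ltP 0 q.
- have H x : 0 <= x -> 0 < q + d * x.
    by move=> x0; rewrite ltr_wpDr // mulr_ge0.
  exists (m1, if 0 < q + (g2 - g1) * m1 then m2 else p2); split => /=.
    by rewrite H //; case: ifP.
  move=> [x y] /= [xE yE].
  have y0 : 0 <= y by rewrite yE; case: ifP.
  by move: xE; rewrite H // => xE; rewrite yE xE.
- have H x : 0 <= x -> (0 < q + (g2 - g1) * x) = false.
    by move=> x0; rewrite E ltNge subr_le0 (le_trans q0) // mulr_ge0.
  exists (if 0 < q + d * p2 then m1 else p1, p2); split => /=.
    by rewrite H //; case: ifP.
  move=> [x y] /= [xE yE].
  have x0 : 0 <= x by rewrite xE; case: ifP.
  by move: yE; rewrite H // => yE; rewrite xE yE.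
- have H x : 0 <= x -> 0 < q + (g2 - g1) * x.
    by move=> x0; rewrite E -mulNr ltr_wpDr // mulr_ge0 // oppr_ge0 ltW.
  exists (if 0 < q + d * m2 then m1 else p1, m2); split => /=.
    by rewrite H //; case: ifP.
  move=> [x y] /= [xE yE].
  have x0 : 0 <= x by rewrite xE; case: ifP.
  by move: yE; rewrite H // => yE; rewrite xE yE.
- have H x : 0 <= x -> (0 < q + d * x) = false.
    move=> x0; apply/negbTE; rewrite -leNgt -[leRHS]addr0 lerD //.
    by rewrite mulr_le0_ge0 // ltW.
  exists (p1, if 0 < q + (g2 - g1) * p1 then m2 else p2); split => /=.
    by rewrite H //; case: ifP.
  move=> [x y] /= [xE yE].
  have y0 : 0 <= y by rewrite yE; case: ifP.
  by move: xE; rewrite H // => xE; rewrite yE xE.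
Qed.

(* By [upstream_pair_exists_unique] the chosen pair is the only admissible one
   for nonnegative mobilities, so the default value of [xget] plays no role. *)
Definition interface_flux (R : realType) (q g1 g2 : R)
    (l1m l2m l1p l2p : R -> R) (a b : R) : R :=
  let p := xget (0, 0)
    [set p | upstream_pair q g1 g2 (l1m a) (l2m a) (l1p b) (l2p b) p] in
  mobility_flux q g1 g2 p.1 p.2.

(* Main.v *)
Require Import Defs.
From mathcomp Require Import all_boot all_order all_algebra.
From mathcomp Require Import mathcomp_extra boolp classical_sets set_interval reals.
From mathcomp Require Import topology normedtype.
From mathcomp Require Import derive ring lra.

(** Put [d := g1 - g2] and let [(x, y)] be the upstream pair.  The number
    [t := (q + d y) / (x + y)] has the sign of the quantity deciding the upwind
    direction of phase 1, and [t - d] that of phase 2, so that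
    [F a b = A t] and [q - F a b = B t] with
    [A t = l1m a t^+ - l1p b t^-] and
    [B t = l2m a (t - d)^+ - l2p b (t - d)^-].  Thus [t] solves
    [A t + B t = q] with [A] and [B] nondecreasing.  Increasing [a] or
    decreasing [b] raises [A] and lowers [B] pointwise, which forces the value
    [A t] at the solution to grow, by at most the change of [A] plus that of [B]
    at the old [t].  Since [t] is bounded and the mobilities are Lipschitz, so is
    [F]. *)

Set Implicit Arguments.
Unset Strict Implicit.
Unset Printing Implicit Defensive.

Import Order.TTheory GRing.Theory Num.Theory.
Import numFieldTopology.Exports numFieldNormedType.Exports.

Local Open Scope classical_set_scope.
Local Open Scope ring_scope.

(** * Regularity and positivity of the mobilities *)

(** Away from [x], [f y] is the difference quotient times [y - x], plus [f x], and the first term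
    tends to 0. The point [x] itself is then put back, where the limit is attained. *)
Lemma is_derive_in_cvg (R : realType) (A : set R) (f : R -> R) (x l : R) :
  is_derive_in A f x l -> f y @[y --> within A (nbhs x)] --> f x.
Proof.
move=> fxl.
have fx : f y @[y --> within A x^'] --> f x.
  have F : Filter (within A x^') by exact: within_filter.
  have idx : y @[y --> within A x^'] --> x.
    by move=> U /nbhs_dnbhs; rewrite /nbhs /= /within /=; apply: filterS.
  have neqx : within A x^' [set y | y != x].
    by apply: filterS (nbhs_dnbhs_neq x) => y.
  move: fxl F idx neqx; rewrite /is_derive_in.
  move: (within A x^') => G fxl F idx neqx.
  have H : (f y - f x) / (y - x) * (y - x) + f x @[y --> G] --> l * (x - x) + f x.
    by apply: cvgD (cvg_cst _); apply: cvgM fxl _; apply: cvgB idx (cvg_cst _).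
  move: H; rewrite subrr mulr0 add0r; apply: cvg_trans.
  apply: near_eq_cvg; apply: filterS neqx => y /= yx.
  by rewrite mulfVK ?subrK // subr_eq0.
move=> U Ufx; have H : \forall y \near x, y != x -> A y -> U (f y) := fx _ Ufx.
suff: \forall y \near x, A y -> U (f y) by [].
apply: filterS H => y H Ay; have [->|yx] := eqVneq y x; last exact: H.
exact: nbhs_singleton.
Qed.

(** Makes the mean value theorem available for relative derivatives: near an interior point the
    restriction to [A] is vacuous. *)
Lemma is_derive_in_interior (R : realType) (A : set R) (f : R -> R) (x l : R) :
  nbhs x A -> is_derive_in A f x l -> is_derive x 1 f l.
Proof.
move=> xA fxl.
have H : h^-1 *: (f (h *: 1 + x) - f x) @[h --> 0^'] --> l.
  have sx : (h + x) @[h --> 0^'] --> within A x^'.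
    move=> U UA; have {}UA : \forall y \near x, y != x -> A y -> U y := UA.
    have Ux : \forall y \near x, y != x -> U y.
      by apply: filterS2 UA xA => y H Ay yx; exact: H.
    have hx : (h + x) @[h --> 0] --> x.
      by rewrite -[X in _ --> X]add0r; apply: cvgD; [exact: cvg_id|exact: cvg_cst].
    suff: \forall h \near (0 : R), h != 0 -> U (h + x) by [].
    have H : \forall h \near (0 : R), h + x != x -> U (h + x) := hx _ Ux.
    by apply: filterS H => h H h0; apply: H; rewrite -subr_eq0 addrK.
  apply: cvg_trans (cvg_comp _ _ sx fxl).
  by apply: near_eq_cvg; near=> h; rewrite /= addrK mulrC [_ *: 1]mulr1.
split; first by apply/cvg_ex; exists l.
exact: cvg_lim.
Unshelve. all: by end_near. Qed.

(** The mean value theorem bounds the slopes by the maximum of [|D 1|] over the compact interval.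
    This maximum exists because [D 1] has the derivative [D 2] and is therefore continuous. *)
Lemma smooth_in_lipschitz (R : realType) (a b : R) (f : R -> R) :
  smooth_in `[a, b] f ->
  exists2 k : R, 0 <= k &
    {in `[a, b] &, forall x y, `|f x - f y| <= k * `|x - y|}.
Proof.
move=> [D [D0 dD]].
have cD n : {within `[a, b], continuous (D n)}.
  by apply/subspace_continuousP => x /dD /is_derive_in_cvg; exact.
have [ba|ab] := ltP b a.
  exists 0 => // x y xab; have : a <= b.
    by apply: (@le_trans _ _ x); rewrite (itvP xab).
  by rewrite leNgt ba.
have [c _ cmax] : exists2 c, c \in `[a, b] &
    forall t, t \in `[a, b] -> `|D 1%N t| <= `|D 1%N c|.
  apply: (@EVT_max R (fun t => `|D 1%N t|)) => //.
  apply/subspace_continuousP => x xab.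
  by apply: cvg_norm; exact: (subspace_continuousP _ _).1 (cD 1%N) _ xab.
exists `|D 1%N c| => //.
have lipw x y : x \in `[a, b] -> y \in `[a, b] -> x <= y ->
    `|f x - f y| <= `|D 1%N c| * `|x - y|.
  move=> xab yab xy; rewrite distrC [`|x - y|]distrC.
  have sub z : z \in `[x, y] -> z \in `[a, b].
    move: xab yab; rewrite !in_itv /= => /andP[ax _] /andP[_ yb] /andP[xz zy].
    by rewrite (le_trans ax xz) (le_trans zy yb).
  have [||z zxy] := @MVT_segment R (D 0%N) (D 1%N) x y xy.
  - move=> z; rewrite in_itv /= => /andP[xz zy].
    apply: (@is_derive_in_interior _ `[a, b]); last first.
      by apply: dD; apply: sub; rewrite in_itv /= !ltW.
    have : z \in `]x, y[ by rewrite in_itv /= xz.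
    move=> /near_in_itvoo; apply: filterS => w wxy.
    by apply: sub; exact: subset_itv_oo_cc wxy.
  - by apply: continuous_subspaceW (cD 0%N) => z; exact: sub.
  rewrite !D0 ?inE // => ->; rewrite normrM ler_wpM2r //.
  by apply: cmax; exact: sub.
move=> x y xab yab; have [xy|/ltW yx] := leP x y; first exact: lipw.
by rewrite distrC [`|x - y|]distrC lipw.
Qed.

(** Up to the midpoint [l2] is at least [l2 2^-1], and from there on [l1] is at least [l1 2^-1].
    Both values are positive by strict monotonicity. *)
Lemma mobilities_sum_ge (R : realType) (l1 l2 : R -> R) :
  mobilities l1 l2 ->
  exists2 c, 0 < c & {in `[0, 1], forall s, c <= l1 s + l2 s}.
Proof.
move=> [_ _ l1_ge0 l2_ge0 l1_incr l2_decr l10 l21].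
have h01 : 2^-1 \in `[0 : R, 1] by rewrite in_itv /=; lra.
have i0 : 0 \in `[0 : R, 1] by rewrite in_itv /=; lra.
have i1 : 1 \in `[0 : R, 1] by rewrite in_itv /=; lra.
exists (Num.min (l1 2^-1) (l2 2^-1)).
  rewrite lt_min -{1}l10 -{2}l21 l1_incr ?l2_decr //; lra.
move=> s s01; rewrite ge_min; apply/orP.
have [hs|hs|<-] := ltgtP 2^-1 s; [left|right|left].
- by rewrite ler_wpDr ?l2_ge0 // ltW // l1_incr.
- by rewrite ler_wpDl ?l1_ge0 // ltW // l2_decr.
- by rewrite ler_wpDr ?l2_ge0.
Qed.

(** * Upwind functions and the potential of an upstream pair *)

(** This is [m t^+ - p t^-], the common form of [A] and [B]. *)
Definition upwind (R : realType) (m p t : R) : R :=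
  if 0 < t then m * t else p * t.

Lemma upwind_homo (R : realType) (m p : R) :
  0 <= m -> 0 <= p -> {homo upwind m p : s t / s <= t}.
Proof.
move=> m0 p0 s t st; rewrite /upwind.
case: ltP => s0; case: ltP => t0; nra.
Qed.

Lemma le_upwind (R : realType) (m p m' p' t : R) :
  m <= m' -> p' <= p -> upwind m p t <= upwind m' p' t.
Proof. by move=> mm pp; rewrite /upwind; case: ltP => t0; nra. Qed.

Lemma upwind_dist (R : realType) (m p m' p' t : R) :
  m <= m' -> p' <= p ->
  upwind m' p' t - upwind m p t <= `|t| * ((m' - m) + (p - p')).
Proof.
move=> mm pp; rewrite /upwind.
case: ltP => t0; [rewrite gtr0_norm //|rewrite ler0_norm //]; nra.
Qed.

(** The lower bound [c] is available on each side only, while the pair may mix the two sides. Hence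
    the bounds on [t] and [t - d] are split by whether both phases are taken from the same side. *)
Lemma upstream_potential (R : realType) (q g1 g2 m1 m2 p1 p2 c : R) (p : R * R) :
  0 <= m1 -> 0 <= m2 -> 0 <= p1 -> 0 <= p2 ->
  0 < c -> c <= m1 + m2 -> c <= p1 + p2 ->
  upstream_pair q g1 g2 m1 m2 p1 p2 p ->
  exists t, [/\ `|t| <= `|q| / c + `|g1 - g2|,
    `|t - (g1 - g2)| <= `|q| / c + `|g1 - g2|,
    mobility_flux q g1 g2 p.1 p.2 = upwind m1 p1 t &
    q - mobility_flux q g1 g2 p.1 p.2 = upwind m2 p2 (t - (g1 - g2))].
Proof.
move=> m10 m20 p10 p20 c0 cm cp; case: p => x y [/= xE yE].
rewrite -(opprB g1) mulNr in yE *.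
rewrite /mobility_flux; move: (g1 - g2) xE yE => d xE yE.
have x0 : 0 <= x by rewrite xE; case: ifP.
have y0 : 0 <= y by rewrite yE; case: ifP.
have q0 : 0 <= `|q| / c by rewrite divr_ge0 // ltW.
(* If [x = y = 0] then both sign conditions read [0 < q], so that both phases
   come from the same side, where [x + y >= c]. *)
have xy0 : 0 < x + y.
  rewrite lt_def addr_ge0 // andbT paddr_eq0 //.
  apply/negP => /andP[/eqP x00 /eqP y00]; move: xE yE.
  by rewrite x00 y00 !mulr0 oppr0 addr0; case: ltP => _; lra.
set t := (q + d * y) / (x + y).
have txy : t * (x + y) = q + d * y by rewrite mulfVK // gt_eqF.
have tdE : t - d = (q - d * x) / (x + y).
  by rewrite /t; field; rewrite gt_eqF.
have FE : x / (x + y) * (q + d * y) = x * t by rewrite /t mulrAC mulrA.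
have ut : (0 < t) = (0 < q + d * y) by rewrite /t pmulr_lgt0 ?invr_gt0.
have vt : (0 < t - d) = (0 < q - d * x) by rewrite tdE pmulr_lgt0 ?invr_gt0.
(* Used with [e = d], [z = y] for [t], and with [e = - d], [z = x] for [t - d]. *)
have bound (e z : R) : c <= x + y -> 0 <= z <= x + y ->
    `|(q + e * z) / (x + y)| <= `|q| / c + `|e|.
  move=> cxy /andP[z0 zxy]; rewrite normrM (gtr0_norm (x := _^-1)) ?invr_gt0 //.
  rewrite ler_pdivrMr // mulrDl (le_trans (ler_normD _ _)) // lerD //.
    by rewrite -mulrA ler_peMr // mulrC ler_pdivlMr ?mul1r.
  by rewrite normrM (ger0_norm z0) ler_wpM2l.
have tb : c <= x + y \/ `|t| <= `|d| /\ `|t - d| <= `|d|.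
  (* If the phases flow in opposite directions, [t] lies between 0 and [d]. *)
  move: xE yE; rewrite -ut -vt.
  case: ltP => t0; case: ltP => td0 xE yE; [left|right|right|left].
  - by rewrite xE yE.
  - by rewrite (gtr0_norm t0) (ler0_norm td0) ger0_norm; lra.
  - by rewrite (ler0_norm t0) (gtr0_norm td0) ltr0_norm; lra.
  - by rewrite xE yE.
exists t; rewrite FE /upwind ut vt; split.
- case: tb => [cxy|[td _]]; last by rewrite ler_wpDl.
  by apply: bound => //; rewrite y0 lerDr.
- case: tb => [cxy|[_ td]]; last by rewrite ler_wpDl.
  by rewrite tdE -mulNr -(normrN d); apply: bound => //; rewrite x0 lerDl.
- by rewrite [in LHS]xE; case: ifP.
- have -> : q - x * t = y * (t - d) by lra.
  by rewrite [in LHS]yE; case: ifP.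
Qed.

(** * Comparison of two interface states *)

(** If [t <= t'], then [A t <= A t' <= A' t'], while [B' t <= B' t'] and the balance give the upper
    bound. Otherwise [A' t' <= A' t] gives the upper bound, and [B' t' <= B t' <= B t] with the
    balance gives the lower one. *)
Lemma balance_comparison (R : realType) (A A' B B' : R -> R) (t t' : R) :
  {homo A : s s' / s <= s'} -> {homo A' : s s' / s <= s'} ->
  {homo B : s s' / s <= s'} -> {homo B' : s s' / s <= s'} ->
  (forall s, A s <= A' s) -> (forall s, B' s <= B s) ->
  A t + B t = A' t' + B' t' ->
  A t <= A' t' <= A t + ((A' t - A t) + (B t - B' t)).
Proof.
move=> Ah A'h Bh B'h AA BB E.
have [tt|/ltW tt] := leP t t'.
  have := Ah _ _ tt; have := AA t'; have := B'h _ _ tt; have := AA t; lra.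
have := A'h _ _ tt; have := Bh _ _ tt; have := BB t'; have := BB t; lra.
Qed.

(** The smaller of the two lower bounds on the total mobility serves both sides and all arguments,
    so the bound [T] is uniform in [a] and [b]. *)
Lemma interface_flux_potential (R : realType) (q g1 g2 : R)
    (l1m l2m l1p l2p : R -> R) :
  mobilities l1m l2m -> mobilities l1p l2p ->
  exists2 T : R, 0 <= T & {in `[0, 1] &, forall a b,
    let F := interface_flux q g1 g2 l1m l2m l1p l2p a b in
    exists t, [/\ `|t| <= T, `|t - (g1 - g2)| <= T,
      F = upwind (l1m a) (l1p b) t &
      q - F = upwind (l2m a) (l2p b) (t - (g1 - g2))]}.
Proof.
move=> mobm mobp.
have [cm cm0 cmP] := mobilities_sum_ge mobm.
have [cp cp0 cpP] := mobilities_sum_ge mobp.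
set c := Num.min cm cp.
have c0 : 0 < c by rewrite lt_min cm0.
exists (`|q| / c + `|g1 - g2|).
  by rewrite addr_ge0 // divr_ge0 // ltW.
move=> a b a01 b01 /=.
have pos := (mob1_ge0 mobm a01, mob2_ge0 mobm a01,
             mob1_ge0 mobp b01, mob2_ge0 mobp b01).
apply: upstream_potential; rewrite ?pos //.
- by rewrite ge_min cmP.
- by rewrite ge_min cpP ?orbT.
have [||||p [pP _]] := @upstream_pair_exists_unique R q g1 g2
  (l1m a) (l2m a) (l1p b) (l2p b); rewrite ?pos //.
exact: xgetI pP.
Qed.

(** Moving both arguments in the direction that raises the flux yields monotonicity and the
    Lipschitz estimate at once. *)
Lemma interface_flux_comparison (R : realType) (q g1 g2 : R)
    (l1m l2m l1p l2p : R -> R) :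
  mobilities l1m l2m -> mobilities l1p l2p ->
  exists L : R,
    {in `[0, 1] &, forall a a', {in `[0, 1] &, forall b b', a <= a' -> b' <= b ->
      let F := interface_flux q g1 g2 l1m l2m l1p l2p in
      F a b <= F a' b' <= F a b + L * ((a' - a) + (b - b'))}}.
Proof.
move=> mobm mobp.
have [k1m k1m0 k1mP] := smooth_in_lipschitz (mob1_smooth mobm).
have [k2m k2m0 k2mP] := smooth_in_lipschitz (mob2_smooth mobm).
have [k1p k1p0 k1pP] := smooth_in_lipschitz (mob1_smooth mobp).
have [k2p k2p0 k2pP] := smooth_in_lipschitz (mob2_smooth mobp).
have [T T0 potential] := interface_flux_potential q g1 g2 mobm mobp.
(* The factor [T] bounds the potentials of both phases, and each mobility contributes its Lipschitz
   constant. *)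
exists (T * (k1m + k2m + k1p + k2p)).
move=> a a' a01 a'01 b b' b01 b'01 aa bb.
set F := interface_flux _ _ _ _ _ _ _.
have [t [tT tdT Ft qFt]] := potential a b a01 b01.
have [t' [_ _ Ft' qFt']] := potential a' b' a'01 b'01.
have m1 := ltW_homo_in (mob1_incr mobm) a01 a'01 aa.
have m2 := ltW_nhomo_in (mob2_decr mobm) a'01 a01 aa.
have p1 := ltW_homo_in (mob1_incr mobp) b'01 b01 bb.
have p2 := ltW_nhomo_in (mob2_decr mobp) b01 b'01 bb.
(* Here [F a b = A t] and [q - F a b = B t], so both increments are taken at the old [t]. *)
have /andP[mono lip] : F a b <= F a' b' <= F a b +
    ((upwind (l1m a') (l1p b') t - F a b) +
     (q - F a b - upwind (l2m a') (l2p b') (t - (g1 - g2)))).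
  have := @balance_comparison R
    (upwind (l1m a) (l1p b)) (upwind (l1m a') (l1p b'))
    (fun s => upwind (l2m a) (l2p b) (s - (g1 - g2)))
    (fun s => upwind (l2m a') (l2p b') (s - (g1 - g2))) t t'.
  rewrite -Ft -Ft' -qFt -qFt'; apply.
  - exact: upwind_homo (mob1_ge0 mobm a01) (mob1_ge0 mobp b01).
  - exact: upwind_homo (mob1_ge0 mobm a'01) (mob1_ge0 mobp b'01).
  - move=> s s' ss.
    by rewrite (upwind_homo (mob2_ge0 mobm a01) (mob2_ge0 mobp b01)) ?lerB.
  - move=> s s' ss.
    by rewrite (upwind_homo (mob2_ge0 mobm a'01) (mob2_ge0 mobp b'01)) ?lerB.
  - by move=> s; exact: le_upwind.
  - by move=> s; exact: le_upwind.
  - by rewrite !subrKC.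
rewrite mono /=; apply: le_trans lip _; rewrite lerD2l.
have dist (l : R -> R) (k x y : R) :
    {in `[0, 1] &, forall x y, `|l x - l y| <= k * `|x - y|} ->
    x \in `[0, 1] -> y \in `[0, 1] -> x <= y -> `|l x - l y| <= k * (y - x).
  move=> lk x01 y01 xy.
  by rewrite (le_trans (lk _ _ x01 y01)) // ler0_norm ?subr_le0 // opprB.
have := dist _ _ _ _ k1mP a01 a'01 aa.
have := dist _ _ _ _ k2mP a01 a'01 aa.
have := dist _ _ _ _ k1pP b'01 b01 bb.
have := dist _ _ _ _ k2pP b'01 b01 bb.
rewrite !ler_norml => /andP[_ h2p] /andP[h1p _] /andP[_ h2m] /andP[h1m _].
have up1 : upwind (l1m a') (l1p b') t - F a b <=
    T * ((l1m a' - l1m a) + (l1p b - l1p b')).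
  rewrite [F a b]Ft (le_trans (upwind_dist t m1 p1)) // ler_wpM2r //.
  by rewrite addr_ge0 // subr_ge0.
have up2 : q - F a b - upwind (l2m a') (l2p b') (t - (g1 - g2)) <=
    T * ((l2m a - l2m a') + (l2p b' - l2p b)).
  rewrite [q - F a b]qFt (le_trans (upwind_dist _ m2 p2)) // ler_wpM2r //.
  by rewrite addr_ge0 // subr_ge0.
apply: le_trans (lerD up1 up2) _; rewrite -mulrDr -mulrA ler_wpM2l //.
have db0 : 0 <= b - b' by rewrite subr_ge0.
have da0 : 0 <= a' - a by rewrite subr_ge0.
(* The minus constants multiply only [a' - a] and the plus constants only [b - b']; the missing
   cross terms are nonnegative. *)
have := mulr_ge0 (addr_ge0 k1m0 k2m0) db0.
have := mulr_ge0 (addr_ge0 k1p0 k2p0) da0.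
lra.
Qed.

Theorem lemma5p3 (R : realType) (q g1 g2 : R) (l1m l2m l1p l2p : R -> R)
    (mobm : mobilities l1m l2m) (mobp : mobilities l1p l2p) :
  let F := interface_flux q g1 g2 l1m l2m l1p l2p in
  let fm := phase_flux q g1 g2 l1m l2m in
  let fp := phase_flux q g1 g2 l1p l2p in
  [/\ exists L : R,
        (forall b : R, b \in `[0, 1] -> L.-lipschitz_`[0, 1] (F^~ b)) /\
        (forall a : R, a \in `[0, 1] -> L.-lipschitz_`[0, 1] (F a)),
      forall b : R, b \in `[0, 1] ->
        {in `[0, 1] &, {homo F^~ b : a a' / a <= a'}},
      forall a : R, a \in `[0, 1] ->
        {in `[0, 1] &, {homo F a : b b' /~ b <= b'}},
      [/\ F 0 0 = 0, fm 0 = 0 & fp 0 = 0] &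
      [/\ F 1 1 = q, fm 1 = q & fp 1 = q]].
Proof.
move=> F fm fp.
have [L cmp] := interface_flux_comparison q g1 g2 mobm mobp.
have i0 : 0 \in `[0 : R, 1] by rewrite in_itv /=; lra.
have i1 : 1 \in `[0 : R, 1] by rewrite in_itv /=; lra.
split.
- exists L; split => [b b01|a a01] [x y] [/= x01 y01].
    have [xy|/ltW xy] := leP x y.
      have /andP[] := cmp x y x01 y01 b b b01 b01 xy (lexx b).
      rewrite subrr addr0 => mono lip.
      by rewrite !ler0_norm ?subr_le0 // !opprB lerBlDl.
    have /andP[] := cmp y x y01 x01 b b b01 b01 xy (lexx b).
    rewrite subrr addr0 => mono lip.
    by rewrite !ger0_norm ?subr_ge0 // lerBlDl.
  have [xy|/ltW xy] := leP x y.
    have /andP[] := cmp a a a01 a01 y x y01 x01 (lexx a) xy.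
    rewrite subrr add0r => mono lip.
    rewrite ger0_norm ?subr_ge0 // [`|x - y|]ler0_norm ?subr_le0 // opprB.
    by rewrite lerBlDl.
  have /andP[] := cmp a a a01 a01 x y x01 y01 (lexx a) xy.
  rewrite subrr add0r => mono lip.
  rewrite ler0_norm ?subr_le0 // [`|x - y|]ger0_norm ?subr_ge0 // opprB.
  by rewrite lerBlDl.
- move=> b b01 a a' a01 a'01 aa.
  by have /andP[] := cmp a a' a01 a'01 b b b01 b01 aa (lexx b).
- move=> a a01 b b' b01 b'01 bb.
  by have /andP[] := cmp a a a01 a01 b b' b01 b'01 (lexx a) bb.
- rewrite /fm /fp /phase_flux /mobility_flux (mob1_at0 mobm).
  rewrite (mob1_at0 mobp) !mul0r; split=> //.
  (* Both mobilities of phase 1 vanish at 0, so [A t = 0] whatever the sign of [t]. *)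
  have [T _ /(_ 0 0 i0 i0) [t [_ _ + _]]] :=
    interface_flux_potential q g1 g2 mobm mobp.
  by rewrite (mob1_at0 mobm) (mob1_at0 mobp) /upwind mul0r if_same.
- have l1_neq0 (l1 l2 : R -> R) : mobilities l1 l2 -> l1 1 != 0.
    move=> mob; have := mob1_incr mob i0 i1 ltr01.
    by rewrite (mob1_at0 mob) => /gt_eqF ->.
  rewrite /fm /fp /phase_flux /mobility_flux (mob2_at1 mobm).
  rewrite (mob2_at1 mobp) !addr0 mulr0 addr0.
  rewrite !divff ?mul1r ?(l1_neq0 _ _ mobm) ?(l1_neq0 _ _ mobp) //; split=> //.
  (* Both mobilities of phase 2 vanish at 1, so [q - F 1 1 = B t = 0]. *)
  have [T _ /(_ 1 1 i1 i1) [t [_ _ _]]] :=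
    interface_flux_potential q g1 g2 mobm mobp.
  rewrite (mob2_at1 mobm) (mob2_at1 mobp) /upwind mul0r if_same.
  by move=> /subr0_eq ->.
Qed.
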